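(* Let $q=p^r$ be a power of a prime $p$ and $n\ge1$ an integer. Let $B\subset\mathbb{F}_q^\times$ be a set of representatives of the cosets of $\mathbb{F}_p^\times$ in $\mathbb{F}_q^\times$. For $\alpha\in\mathbb{F}_q^\times$ and $\beta\in B$ let $C_{\alpha,\beta}$ be the curve over $\mathbb{F}_q$ given by $x(y^p-y)=\beta(\alpha x^2-1)$, i.e. the projective plane curve $xy^p-xyz^{p-1}=\beta(\alpha x^2z^{p-1}-z^{p+1})$, and let $S_{\alpha,\beta}(\mathbb{F}_{q^n})=\#C_{\alpha,\beta}(\mathbb{F}_{q^n})-(q^n+1)$, where $\#C_{\alpha,\beta}(\mathbb{F}_{q^n})$ is the number of its points in $\mathbb{P}^2(\mathbb{F}_{q^n})$. Then \[ F_q(n,0,0)=q^{n-2}+\frac{(q-1)^2}{q^2}+\frac1{q^2}\sum_{\alpha\in\mathbb{F}_q^\times}\sum_{\beta\in B}S_{\alpha,\beta}(\mathbb{F}_{q^n}). \]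
   Context: For $a\in\mathbb{F}_{q^n}$, $\mathrm{Tr}(a)=\sum_{i=0}^{n-1}a^{q^i}$ and $\mathrm{rTr}(a)=\sum_{i=0}^{n-1}a^{-q^i}$, with the convention $\mathrm{rTr}(0)=0$. $F_q(n,0,0)$ is the number of $a\in\mathbb{F}_{q^n}$ with $\mathrm{Tr}(a)=0$ and $\mathrm{rTr}(a)=0$. *)

(* Defs.v *)
From mathcomp Require Export all_boot all_order all_algebra all_field.
From mathcomp Require Export mpoly.

Set Implicit Arguments.
Unset Strict Implicit.
Unset Printing Implicit Defensive.

Import GRing.Theory.

Local Open Scope ring_scope.

Section Traces.
Variables (L : finFieldType) (q n : nat).

Definition Tr (a : L) : L := \sum_(i < n) a ^+ (q ^ i).

(* The convention rTr(0) = 0 is built in, because 0^-1 = 0; see rTr0. *)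
Definition rTr (a : L) : L := \sum_(i < n) a ^- (q ^ i).

(* F_q(n,0,0), when #|L| = q ^ n. *)
Definition F00 : nat := #|[set a : L | (Tr a == 0) && (rTr a == 0)]|.

End Traces.

Lemma rTr0 (L : finFieldType) (q n : nat) : (0 < q)%N -> rTr q n (0 : L) = 0.
Proof.
move=> q_gt0; rewrite /rTr big1 // => i _.
by rewrite expr0n eqn0Ngt expn_gt0 q_gt0 /= invr0.
Qed.

(* P^2(L), a point being the set of all its homogeneous coordinate vectors. *)
Section ProjectivePlane.
Variable L : finFieldType.

Definition homog_class (v : 'rV[L]_3) : {set 'rV[L]_3} :=
  [set c *: v | c in [set c : L | c != 0]].

Definition P2 : {set {set 'rV[L]_3}} :=
  [set homog_class v | v in [set v : 'rV[L]_3 | v != 0]].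

End ProjectivePlane.
Arguments P2 L : clear implicits.

(* L-points of the projective plane curve defined by a homogeneous polynomial f
   over F, for an extension iota : F -> L. *)
Definition curve_points (F L : finFieldType) (iota : {rmorphism F -> L})
    (f : {mpoly F[3]}) : {set {set 'rV[L]_3}} :=
  [set P in P2 L | [forall v in P, (map_mpoly iota f).@[fun i => v 0 i] == 0]].

Section Curve.
Variables (F : finFieldType) (p : nat).

Definition curve_poly (alpha beta : F) : {mpoly F[3]} :=
  let x : {mpoly F[3]} := 'X_(inord 0) in
  let y : {mpoly F[3]} := 'X_(inord 1) in
  let z : {mpoly F[3]} := 'X_(inord 2) in
  (x * y ^+ p - x * y * z ^+ p.-1)
  - beta *: (alpha *: (x ^+ 2 * z ^+ p.-1) - z ^+ p.+1).

(* S_{alpha,beta}(L) *)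
Definition S_ab (L : finFieldType) (iota : {rmorphism F -> L})
    (alpha beta : F) : int :=
  #|curve_points iota (curve_poly alpha beta)|%:Z - (#|L|.+1)%:Z.

(* F_p^* inside F, when F has characteristic p. *)
Definition prime_units : {set F} := [set k%:R | k : 'I_p & (0 < k)%N].

Definition prime_coset (x : F) : {set F} := [set c * x | c in prime_units].

Definition coset_representatives (B : {set F}) : bool :=
  let Fx := [set x : F | x != 0] in
  is_transversal B [set prime_coset x | x in Fx] Fx.

End Curve.

(* Main.v *)
Require Import Defs.
From mathcomp Require Import all_boot all_order all_algebra all_field.
From mathcomp Require Import ring.

Set Implicit Arguments.
Unset Strict Implicit.
Unset Printing Implicit Defensive.

Import GRing.Theory Num.Theory.

Local Open Scope ring_scope.

(* The curve has two points with z = 0, and its affine points are the solutions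
   of y^p - y = beta (alpha x - 1/x) with x != 0; for a given x there are p of
   them if the absolute trace of the right hand side vanishes, and none
   otherwise. That trace is the absolute trace of beta (alpha s - t), where
   s = Tr x and t = rTr x lie in F_q. For fixed x, the number of beta in B at
   which it vanishes depends only on whether alpha s = t, because its vanishing
   is invariant under F_p^* and the absolute trace has a kernel of index p.
   Counting the alpha != 0 with alpha s = t singles out the x with s = t = 0,
   and summing over x gives the formula. *)

(** * Trace kernels and additive Hilbert 90 by counting roots *)

Lemma card_root_set (L : finFieldType) (P : {poly L}) (d : nat) :
  size P = d.+1 -> (#|[set x | root P x]| <= d)%N.
Proof.
move=> sizeP; rewrite -ltnS -sizeP cardE; apply: max_poly_roots.
- by rewrite -size_poly_eq0 sizeP.
- by apply/allP=> x; rewrite mem_enum inE.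
- exact: enum_uniq.
Qed.

Section PcharTrace.
Variables (L : finFieldType) (q n : nat).
Hypothesis q_pchar : [pchar L].-nat q.

Lemma expr_sum_pchar (I : finType) (f : I -> L) (k : nat) : [pchar L].-nat k ->
  (\sum_i f i) ^+ k = \sum_i f i ^+ k.
Proof.
move=> k_pchar; apply: (big_morph (fun x => x ^+ k)).
  by move=> x y; apply: exprDn_pchar.
by rewrite expr0n; case: k k_pchar.
Qed.

Lemma TrD (x y : L) : Tr q n (x + y) = Tr q n x + Tr q n y.
Proof.
rewrite /Tr -big_split /=; apply: eq_bigr => i _.
by rewrite exprDn_pchar // pnatX q_pchar.
Qed.

Lemma TrMl (c x : L) : c ^+ q = c -> Tr q n (c * x) = c * Tr q n x.
Proof.
move=> cq; rewrite /Tr mulr_sumr; apply: eq_bigr => i _; rewrite exprMn.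
by congr (_ * _); elim: (val i) => // j IHj; rewrite expnS exprM cq.
Qed.

Lemma TrN (x : L) : Tr q n (- x) = - Tr q n x.
Proof.
rewrite /Tr -sumrN; apply: eq_bigr => i _.
by rewrite exprNn_pchar // pnatX q_pchar.
Qed.

Lemma Tr_exp (x : L) : Tr q n x ^+ q = Tr q n (x ^+ q).
Proof.
rewrite /Tr expr_sum_pchar //; apply: eq_bigr => i _.
by rewrite -!exprM mulnC.
Qed.

(** The sum telescopes. When [x ^+ (q ^ n) = x], this is the easy half of additive Hilbert 90. *)
Lemma Tr_exp_sub (x : L) : Tr q n (x ^+ q - x) = x ^+ (q ^ n) - x.
Proof.
rewrite TrD TrN -sumrB /=.
under eq_bigr => i _ do rewrite -exprM -expnS.
rewrite -(big_mkord xpredT (fun i => x ^+ (q ^ i.+1) - x ^+ (q ^ i))).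
by rewrite telescope_sumr.
Qed.

Hypotheses (q_gt1 : (1 < q)%N) (n_gt0 : (0 < n)%N) (card_L : #|L| = (q ^ n)%N).

Lemma Tr_exp_card (x : L) : Tr q n x ^+ q = Tr q n x.
Proof.
apply/eqP; rewrite -subr_eq0 Tr_exp -TrN -TrD Tr_exp_sub -card_L expf_card.
by rewrite subrr.
Qed.

Lemma card_Tr0_le : (#|[set u : L | Tr q n u == 0%R]| <= q ^ n.-1)%N.
Proof.
case: n n_gt0 => // m _ /=.
pose P : {poly L} := \sum_(i < m.+1) 'X^(q ^ i).
have sizeP : size P = (q ^ m).+1.
  rewrite /P big_ord_recr /= addrC size_polyDl size_polyXn // ltnS.
  apply: (leq_trans (size_sum _ _ _)); apply/bigmax_leqP => i _.
  by rewrite size_polyXn ltn_exp2l.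
apply: leq_trans (card_root_set sizeP); apply: subset_leq_card.
apply/subsetP=> u; rewrite !inE rootE /P horner_sum => /eqP Tu.
by apply/eqP; rewrite -[RHS]Tu; apply: eq_bigr => i _; rewrite hornerXn.
Qed.

Lemma card_exp_sub_le (u : L) : (#|[set y : L | (y ^+ q - y == u)%R]| <= q)%N.
Proof.
pose P : {poly L} := 'X^q - ('X + u%:P).
have sizeP : size P = q.+1.
  by rewrite /P size_polyDl ?size_polyN ?size_polyXn ?size_XaddC ?ltnS.
apply: leq_trans (card_root_set sizeP); apply: subset_leq_card.
apply/subsetP=> y; rewrite !inE rootE !hornerE => /eqP <-.
by apply/eqP; ring.
Qed.

(** The map [y ^+ q - y] sends all of [L] into the kernel of the trace, so its fibres over that
    kernel exhaust [L]. *)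
Lemma sum_card_exp_sub :
  (\sum_(u in [set u : L | Tr q n u == 0%R])
     #|[set y : L | (y ^+ q - y == u)%R]|)%N = (q ^ n)%N.
Proof.
rewrite -card_L -sum1_card.
rewrite [RHS](partition_big (fun y : L => y ^+ q - y)
           (fun u => u \in [set u : L | Tr q n u == 0])) /=.
  apply: eq_bigr => u _; rewrite -sum1_card.
  by apply: eq_bigl => y; rewrite !inE.
by move=> y _; rewrite inE Tr_exp_sub -card_L expf_card subrr.
Qed.

(* Both upper bounds coming from degrees are attained, since their product is
   the cardinality of L. *)
Lemma card_Tr0 : #|[set u : L | Tr q n u == 0]| = (q ^ n.-1)%N.
Proof.
apply/eqP; rewrite eqn_leq card_Tr0_le -(leq_pmul2r (ltnW q_gt1)) /=.
rewrite -expnSr prednK // -sum_card_exp_sub -sum_nat_const.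
by apply: leq_sum => u _; apply: card_exp_sub_le.
Qed.

(** Additive Hilbert 90 in counting form: the bound [q] on the fibres over the kernel of the trace
    is attained in total, hence on each of them. *)
Lemma card_exp_sub (u : L) :
  #|[set y : L | (y ^+ q - y == u)%R]| = ((Tr q n u == 0%R) * q)%N.
Proof.
case: eqP => [Tu | Tu]; last first.
  apply/eqP; rewrite cards_eq0; apply/eqP/setP=> y; rewrite !inE.
  apply/eqP=> yu; apply: Tu.
  by rewrite -yu Tr_exp_sub -card_L expf_card subrr.
rewrite mul1n.
have /leqif_sum : forall v, v \in [set u : L | Tr q n u == 0] ->
    (#|[set y : L | (y ^+ q - y == v)%R]| <= q
       ?= iff (#|[set y : L | (y ^+ q - y == v)%R]| == q))%N.
  by move=> v _; split; first exact: card_exp_sub_le.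
move=> [_].
rewrite sum_card_exp_sub sum_nat_const card_Tr0 -expnSr prednK // eqxx.
by move/esym/forall_inP/(_ u); rewrite inE Tu eqxx => /(_ isT)/eqP.
Qed.

(** The trace is fixed by the [q]-th power map, and the [q] elements of the image of [F] already
    exhaust the roots of [y ^+ q - y]. *)
Lemma Tr_codom (F : finFieldType) (iota : {rmorphism F -> L}) :
  #|F| = q -> forall x : L, exists s : F, Tr q n x = iota s.
Proof.
move=> card_F x.
have/eqP E : [set iota s | s in F] == [set y : L | y ^+ q - y == 0].
  rewrite eqEcard; apply/andP; split; last first.
    rewrite card_imset; last exact: fmorph_inj.
    by rewrite card_F card_exp_sub_le.
  apply/subsetP=> _ /imsetP[s _ ->]; rewrite inE -rmorphXn -card_F expf_card.
  by rewrite subrr.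
have : Tr q n x \in [set y : L | y ^+ q - y == 0].
  by rewrite inE Tr_exp_card subrr.
by rewrite -E => /imsetP[s _ ->]; exists s.
Qed.

End PcharTrace.

Lemma rTrE (L : finFieldType) (q n : nat) (x : L) : rTr q n x = Tr q n x^-1.
Proof. by apply: eq_bigr => i _; rewrite exprVn. Qed.

Lemma Tr_rmorph (F L : finFieldType) (iota : {rmorphism F -> L}) (q n : nat)
  (x : F) : Tr q n (iota x) = iota (Tr q n x).
Proof. by rewrite /Tr rmorph_sum; apply: eq_bigr => i _; rewrite rmorphXn. Qed.

(** Transitivity of the trace, here a formal identity: every index below [n * r] is uniquely
    [i * r + j] with [j < r]. *)
Lemma Tr_tower (L : finFieldType) (p r n : nat) (x : L) : [pchar L].-nat p ->
  Tr p (n * r) x = Tr p r (Tr (p ^ r) n x).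
Proof.
move=> p_pchar; elim: n x => [|n IHn] x.
  rewrite mul0n /Tr !big_ord0 big1 // => i _.
  by rewrite expr0n eqn0Ngt expn_gt0; case: p p_pchar.
(* The first [r] indices sum to [Tr p r x]; the others are shifted by [r], which amounts to
   replacing [x] by [x ^+ (p ^ r)]. *)
have -> : Tr p (n.+1 * r) x = Tr p r x + Tr p (n * r) (x ^+ (p ^ r)).
  rewrite /Tr mulSn big_split_ord /=; congr (_ + _).
  by apply: eq_bigr => i _; rewrite -exprM expnD.
rewrite IHn -TrD //; congr (Tr _ _ _).
rewrite [RHS]/Tr big_ord_recl /= expr1; congr (_ + _).
by apply: eq_bigr => i _; rewrite -exprM -expnS.
Qed.

(** * Points of the projective curve *)

Section ProjectiveCurve.
Variables (F L : finFieldType) (iota : {rmorphism F -> L}) (p : nat).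
Variables (alpha beta : F).
Hypotheses (p_gt1 : (1 < p)%N) (beta_neq0 : beta != 0).

Definition vec3 (x y z : L) : 'rV[L]_3 := \row_(i < 3) [:: x; y; z]`_i.

Lemma vec3E (x y z : L) :
  ((vec3 x y z 0 (inord 0) = x) * (vec3 x y z 0 (inord 1) = y)
   * (vec3 x y z 0 (inord 2) = z))%type.
Proof. by rewrite !mxE !inordK. Qed.

Lemma vec3P (v : 'rV[L]_3) : exists x y z, v = vec3 x y z.
Proof.
exists (v 0 (inord 0)), (v 0 (inord 1)), (v 0 (inord 2)).
apply/rowP=> i; rewrite mxE.
case: i => -[|[|[|//]]] lti /=; congr (v 0 _); apply/val_inj.
all: by rewrite /= inordK.
Qed.

Lemma scale_vec3 (c x y z : L) : c *: vec3 x y z = vec3 (c * x) (c * y) (c * z).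
Proof. by apply/rowP=> i; rewrite !mxE; case: i => -[|[|[|//]]]. Qed.

Lemma vec3_inj (x y z x' y' z' : L) :
  vec3 x y z = vec3 x' y' z' -> [/\ x = x', y = y' & z = z'].
Proof.
move=> /rowP E; split.
- by have := E (inord 0); rewrite !vec3E.
- by have := E (inord 1); rewrite !vec3E.
- by have := E (inord 2); rewrite !vec3E.
Qed.

Lemma vec3_eq0 (x y z : L) :
  (vec3 x y z == 0) = [&& x == 0, y == 0 & z == 0].
Proof.
have -> : 0 = vec3 0 0 0.
  by apply/rowP=> i; rewrite !mxE; case: i => -[|[|[|//]]].
apply/eqP/and3P=> [/vec3_inj[-> -> ->] // | [/eqP-> /eqP-> /eqP-> //]].
Qed.

Definition curve_val (x y z : L) : L :=
  x * y ^+ p - x * y * z ^+ p.-1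
  - iota beta * (iota alpha * (x ^+ 2 * z ^+ p.-1) - z ^+ p.+1).

Lemma curve_polyE (x y z : L) :
  (map_mpoly iota (curve_poly p alpha beta)).@[fun i => vec3 x y z 0 i]
  = curve_val x y z.
Proof.
rewrite /curve_poly !rmorphB /= !map_mpolyZ !mevalZ !rmorphB /= !map_mpolyZ.
by rewrite !mevalZ !(rmorphM, rmorphXn) /= !map_mpolyX !mevalXU !vec3E.
Qed.

Lemma curve_val_homog (c x y z : L) :
  curve_val (c * x) (c * y) (c * z) = c ^+ p.+1 * curve_val x y z.
Proof.
rewrite /curve_val; case: p p_gt1 => // k _ /=; rewrite !exprMn !exprS; ring.
Qed.

Lemma homog_class_eqP (v w : 'rV[L]_3) :
  reflect (exists2 c, c != 0 & w = c *: v) (homog_class v == homog_class w).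
Proof.
apply: (iffP eqP) => [E | [c c0 ->]].
  have : w \in homog_class w.
    by apply/imsetP; exists 1; rewrite ?inE ?oner_neq0 ?scale1r.
  by rewrite -E => /imsetP[c]; rewrite inE => c0 ->; exists c.
apply/setP=> u; apply/imsetP/imsetP => -[d]; rewrite inE => d0 ->.
  exists (d / c); first by rewrite inE mulf_neq0 ?invr_eq0.
  by rewrite scalerA divfK.
by exists (d * c); rewrite ?inE ?mulf_neq0 // scalerA.
Qed.

(** The chart [z = 1], with the equation divided by [x] into Artin-Schreier form. *)
Definition affine_points : {set L * L} :=
  [set xy | (xy.1 != 0)
            & xy.2 ^+ p - xy.2 == iota beta * (iota alpha * xy.1 - xy.1^-1)].

Lemma curve_val_affine (x y : L) :
  (curve_val x y 1 == 0) = ((x, y) \in affine_points).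
Proof.
rewrite inE /= /curve_val !expr1n !mulr1; have [-> | x0] /= := eqVneq x 0.
  (* At [x = 0] the equation takes the value [iota beta], which is non-zero. *)
  rewrite !mul0r expr0n mulr0 subr0 !sub0r mulrN1 opprK fmorph_eq0.
  exact: negPf.
rewrite -[RHS]subr_eq0 -[RHS](inj_eq (mulfI x0)) mulr0; congr (_ == 0).
by field.
Qed.

(** As [p > 1], the exponent [p.-1] is positive, and only [x * y ^+ p] survives at [z = 0]. *)
Lemma curve_val_infinity (x y : L) :
  (curve_val x y 0 == 0) = (x == 0) || (y == 0).
Proof.
rewrite /curve_val; case: p p_gt1 => [|[|k]] // _ /=.
rewrite !expr0n /= !mulr0 !subr0 mulr0 subr0 mulf_eq0 expf_eq0 //.
Qed.

(** Exactly one coordinate vector for each point of the curve, which turns a count of classes into a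
    count of vectors. *)
Definition normal_vectors : {set 'rV[L]_3} :=
  vec3 1 0 0 |: (vec3 0 1 0 |: [set vec3 xy.1 xy.2 1 | xy in affine_points]).

(** A coordinate vector of a point of the curve is divided by [z], or at infinity by its only
    non-zero coordinate. Conversely, homogeneity carries vanishing from one vector to its whole
    class. *)
Lemma curve_pointsE :
  curve_points iota (curve_poly p alpha beta)
  = [set homog_class v | v in normal_vectors].
Proof.
have hclass x y z c : c != 0 ->
  homog_class (vec3 x y z) = homog_class (vec3 (c * x) (c * y) (c * z)).
  by move=> c0; apply/eqP/homog_class_eqP; exists c; rewrite ?scale_vec3.
apply/setP=> P; apply/idP/imsetP.
  rewrite inE => /andP[/imsetP[v]]; have [x [y [z ->]]] := vec3P v.
  rewrite inE vec3_eq0 => v0 -> /forall_inP/(_ (vec3 x y z)).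
  rewrite curve_polyE => cv0.
  have {cv0} : curve_val x y z == 0.
    by apply: cv0; apply/imsetP; exists 1; rewrite ?inE ?oner_neq0 ?scale1r.
  have [z0 | z0] := eqVneq z 0.
    rewrite z0 curve_val_infinity; have [x0 _ | x0 /= y0] := eqVneq x 0.
      move: v0; rewrite x0 z0 eqxx andbT /= => y0.
      exists (vec3 0 1 0); first by rewrite !inE eqxx orbT.
      by rewrite (hclass 0 1 0 y) // !mulr0 mulr1.
    exists (vec3 1 0 0); first by rewrite !inE eqxx.
    by rewrite (hclass 1 0 0 x) // !mulr0 mulr1 (eqP y0).
  move=> cv; exists (vec3 (z^-1 * x) (z^-1 * y) 1); last first.
    by rewrite (hclass x y z z^-1) ?invr_eq0 // mulVf.
  rewrite !inE; apply/orP; right; apply/orP; right; apply/imsetP.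
  exists (z^-1 * x, z^-1 * y) => //.
  rewrite -curve_val_affine -(mulVf z0) curve_val_homog.
  by rewrite (eqP cv) mulr0.
case=> v v_norm ->.
have [x [y [z [-> v0 cv]]]] : exists x y z,
    [/\ v = vec3 x y z, vec3 x y z != 0 & curve_val x y z = 0].
  move: v_norm; rewrite !inE => /or3P[/eqP->|/eqP->|/imsetP[[x y] xy ->]].
  - exists 1, 0, 0; split=> //; first by rewrite vec3_eq0 oner_eq0.
    by apply/eqP; rewrite curve_val_infinity eqxx orbT.
  - exists 0, 1, 0; split=> //; first by rewrite vec3_eq0 oner_eq0 andbF.
    by apply/eqP; rewrite curve_val_infinity eqxx.
  - exists x, y, 1; split=> //; first by rewrite vec3_eq0 oner_eq0 !andbF.
    by apply/eqP; rewrite curve_val_affine.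
rewrite inE; apply/andP; split.
  by apply/imsetP; exists (vec3 x y z); rewrite ?inE.
apply/forall_inP=> _ /imsetP[c _ ->].
by rewrite scale_vec3 curve_polyE curve_val_homog cv mulr0.
Qed.

Lemma homog_class_inj_normal :
  {in normal_vectors &, injective (@homog_class L)}.
Proof.
move=> v w; rewrite !inE.
move=> /or3P[/eqP->|/eqP->|/imsetP[[x y] _ ->]];
move=> /or3P[/eqP->|/eqP->|/imsetP[[x' y'] _ ->]] //;
move=> /eqP/homog_class_eqP[c c0]; rewrite scale_vec3 => /vec3_inj[];
rewrite ?(mulr0, mulr1).
(* The pairs of equal points at infinity are closed already. The mixed pairs force [1 = 0] or
   [c = 0]; for two affine vectors the last coordinate gives [c = 1]. *)
- by move=> _ /eqP; rewrite oner_eq0.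
- by move=> _ _ /eqP; rewrite oner_eq0.
- by move=> /eqP; rewrite oner_eq0.
- by move=> _ _ /eqP; rewrite oner_eq0.
- by move=> _ _ /esym/eqP; rewrite (negPf c0).
- by move=> _ _ /esym/eqP; rewrite (negPf c0).
- by move=> /= -> -> <-; rewrite !mul1r.
Qed.

Lemma card_curve_points :
  #|curve_points iota (curve_poly p alpha beta)| = #|affine_points|.+2.
Proof.
rewrite curve_pointsE (card_in_imset homog_class_inj_normal).
have not_inf x y :
    vec3 x y 0 \notin [set vec3 xy.1 xy.2 1 | xy in affine_points].
  by apply/negP=> /imsetP[xy _ /vec3_inj[_ _ /esym/eqP]]; rewrite oner_eq0.
rewrite /normal_vectors cardsU1 cardsU1 not_inf !inE negb_or not_inf andbT.
rewrite card_imset => [|[x y] [x' y'] /vec3_inj[/= -> -> _] //].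
case: eqP => [/vec3_inj[/eqP]|] //.
by rewrite oner_eq0.
Qed.
End ProjectiveCurve.

(** * Cosets of the units of the prime field *)

Section CosetRepresentatives.
Variables (F : finFieldType) (p : nat).
Hypothesis F_pchar : p \in [pchar F].

Let p_prime : prime p := pcharf_prime F_pchar.

Lemma prime_units_exp (c : F) : c \in prime_units F p -> c ^+ p = c.
Proof.
move=> /imsetP[k _ ->].
by rewrite -(pFrobenius_autE F_pchar) pFrobenius_aut_nat.
Qed.

Lemma prime_units_neq0 (c : F) : c \in prime_units F p -> c != 0.
Proof.
move=> /imsetP[k]; rewrite inE => k_gt0 ->.
by rewrite -(dvdn_pcharf F_pchar) gtnNdvd.
Qed.

Lemma card_prime_units : #|prime_units F p| = p.-1.
Proof.
rewrite card_in_imset => [|i j _ _ ij].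
  rewrite cardsE -sum1_card.
  rewrite (eq_bigl (fun k : 'I_p => k != 0%N :> nat)); last first.
    by move=> k; apply: lt0n.
  have := prime_gt0 p_prime; case: (p) => // k _.
  by rewrite big_mkcond big_ord_recl /= add0n sum1_card card_ord.
(* Two integers below [p] with the same image differ by a multiple of [p] smaller than [p], hence by
   0. *)
apply/val_inj => /=; wlog le_ij : i j ij / (i <= j)%N.
  by move=> H; case/orP: (leq_total i j) => le_ij; [|apply/esym]; apply: H.
apply/eqP; rewrite eqn_leq le_ij -subn_eq0 /=.
have : (p %| j - i)%N by rewrite (dvdn_pcharf F_pchar) natrB // ij subrr.
apply: contraLR; rewrite -lt0n => ji_gt0; rewrite gtnNdvd //.
by apply: leq_ltn_trans (ltn_ord j); apply: leq_subr.
Qed.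

Lemma prime_coset_refl (x : F) : x \in prime_coset p x.
Proof.
apply/imsetP; exists 1; rewrite ?mul1r //; apply/imsetP.
by exists (Ordinal (prime_gt1 p_prime)); rewrite ?inE.
Qed.

(** The non-zero elements split into cosets of size [p.-1], each meeting [B] once, and [g] is
    constant on each coset. *)
Lemma sum_coset_representatives (B : {set F}) (g : F -> rat) :
    coset_representatives p B ->
    (forall c x, c \in prime_units F p -> g (c * x) = g x) ->
  \sum_(x | x != 0) g x = (p.-1)%:R * \sum_(b in B) g b.
Proof.
move=> B_repr g_inv.
pose P := [set prime_coset p x | x in [set x : F | x != 0]].
have {}B_repr : is_transversal B P [set x : F | x != 0] := B_repr.
have B_sub := transversal_sub B_repr; have [partP _ _] := and3P B_repr.
rewrite (eq_bigl (fun x => x \in [set x : F | x != 0])); last first.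
  by move=> x; rewrite inE.
rewrite (set_partition_big _ partP) /=.
have pblockE b : b \in B -> pblock P b = prime_coset p b.
  move=> /(subsetP B_sub) b0; apply: def_pblock (prime_coset_refl b).
    by have [] := and3P partP.
  exact: imset_f.
(* The blocks are indexed by [B] through [pblock], which is injective on a transversal. *)
rewrite -{1}(pblock_transversal B_repr) big_imset /=; last first.
  exact: pblock_inj B_repr.
rewrite mulr_sumr; apply: eq_bigr => b bB; rewrite pblockE // big_imset /=.
  under eq_bigr => c cu do rewrite g_inv //.
  by rewrite sumr_const card_prime_units mulr_natl.
move=> c d _ _; apply: mulIf.
by have := subsetP B_sub b bB; rewrite inE.
Qed.

End CosetRepresentatives.

(** * Summation of the point counts over the family of curves *)

Lemma Tr0 (L : finFieldType) (q n : nat) : (0 < q)%N -> Tr q n (0 : L) = 0.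
Proof.
move=> q_gt0; rewrite /Tr big1 // => i _.
by rewrite expr0n eqn0Ngt expn_gt0 q_gt0.
Qed.

Lemma sum_nat_of_bool (R : nzRingType) (T : finType) (P : pred T) :
  \sum_x (P x)%:R = #|[set x | P x]|%:R :> R.
Proof.
rewrite -sum1_card natr_sum [RHS]big_mkcond /=.
by apply: eq_bigr => x _; rewrite inE; case: (P x).
Qed.

Lemma sum1_neq0 (F : finFieldType) (R : comNzRingType) :
  \sum_(a : F | a != 0) 1 = #|F|%:R - 1 :> R.
Proof. by rewrite -sumr_const [in RHS](bigD1 0) //=; ring. Qed.

Section Counting.
Variables (p r q n : nat) (F L : finFieldType) (iota : {rmorphism F -> L}).
Variable B : {set F}.
Hypotheses (p_prime : prime p) (q_def : q = (p ^ r)%N) (n_gt0 : (0 < n)%N).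
Hypotheses (card_F : #|F| = q) (card_L : #|L| = (q ^ n)%N).
Hypothesis B_repr : coset_representatives p B.

Let r_gt0 : (0 < r)%N.
Proof.
by have := finNzRing_gt1 F; rewrite card_F q_def; case: (r).
Qed.

Let q_gt1 : (1 < q)%N. Proof. by rewrite -card_F finNzRing_gt1. Qed.

Let F_pchar : p \in [pchar F].
Proof. by apply: card_finPcharP p_prime; rewrite card_F q_def. Qed.

Let L_pchar : p \in [pchar L].
Proof. by rewrite (fmorph_pchar iota). Qed.

Let p_nat_F : [pchar F].-nat p. Proof. by rewrite pnatE. Qed.
Let p_nat_L : [pchar L].-nat p. Proof. by rewrite pnatE. Qed.
Let q_nat_L : [pchar L].-nat q. Proof. by rewrite q_def pnatX p_nat_L. Qed.

Let p_gt1 := prime_gt1 p_prime.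
Let p_gt0 := prime_gt0 p_prime.

Let natr_pred : (p.-1)%:R = p%:R - 1 :> rat.
Proof. by rewrite -subn1 natrB // ltnW. Qed.

(** For [w != 0], multiplication by [w] permutes [F], so the trace vanishes for [p ^ r.-1] values of
    [b]; without [b = 0] they form [p.-1] times the count over [B]. For [w = 0] every [b] counts.
    The factors [p] and [p - 1] avoid division. *)
Lemma sum_Tr0_scaled (w : F) :
  (p%:R - 1) * (p%:R * \sum_(b in B) (Tr p r (b * w) == 0)%:R) =
  q%:R - p%:R + (p%:R - 1) * q%:R * (w == 0)%:R :> rat.
Proof.
pose g b : rat := (Tr p r (b * w) == 0)%:R.
have g_inv c x : c \in prime_units F p -> g (c * x) = g x.
  move=> cu; rewrite /g -mulrA TrMl ?(prime_units_exp F_pchar) //.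
  by rewrite mulf_eq0 (negPf (prime_units_neq0 F_pchar cu)).
have := sum_coset_representatives F_pchar B_repr g_inv.
rewrite natr_pred => sumB.
have total : p%:R * \sum_b g b = q%:R + (p%:R - 1) * q%:R * (w == 0)%:R :> rat.
  have qE : q%:R = p%:R * (p ^ r.-1)%:R :> rat.
    by rewrite -natrM -expnS prednK // q_def.
  have [w0 | w0] := eqVneq w 0.
    rewrite (eq_bigr (fun=> 1)) => [|b _]; last first.
      by rewrite /g w0 mulr0 Tr0 // eqxx.
    by rewrite sumr_const card_F /=; ring.
  rewrite mulr0 addr0 qE; congr (_ * _).
  rewrite -(card_Tr0 p_nat_F p_gt1 r_gt0) ?card_F // -sum_nat_of_bool.
  rewrite [RHS](reindex (fun b => b * w)) //.
  by exists (fun b => b / w) => b _; rewrite (mulfK, divfK).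
rewrite mulrCA -sumB.
(* [total] also counts [b = 0], which accounts for the term [- p]. *)
move: total; rewrite (bigD1 0) //= /g mul0r.
rewrite Tr0 // eqxx mulrDr mulr1 => total.
by apply: (addrI p%:R); rewrite total; ring.
Qed.

(** For [s != 0] the only candidate is [t / s], admissible when [t != 0]; for [s = 0] either all
    [q - 1] values of [a] are solutions or none is. The right-hand side merges the four cases. *)
Lemma card_linear_solutions (s t : F) :
  \sum_(a : F | a != 0) (a * s - t == 0)%:R =
  1 - (s == 0)%:R - (t == 0)%:R + q%:R * ((s == 0) && (t == 0))%:R :> rat.
Proof.
have := sum1_neq0 F rat; rewrite card_F => sum1.
have [-> | s0] := eqVneq s 0.
  rewrite /= (eq_bigr (fun=> (t == 0)%:R)) => [|a _]; last first.
    by rewrite mulr0 sub0r oppr_eq0.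
  by rewrite -(mulr1 (t == 0)%:R) -mulr_sumr sum1; ring.
rewrite (eq_bigr (fun a => (a == t / s)%:R)) => [|a _]; last first.
  by rewrite subr_eq0 -(inj_eq (mulIf s0) a) divfK.
have [-> | t0] := eqVneq t 0.
  by rewrite mul0r big1 => [|a /negPf-> //] /=; ring.
rewrite (bigD1 (t / s)) ?mulf_neq0 ?invr_eq0 //= eqxx.
by rewrite big1 => [|a /andP[_ /negPf->] //] /=; ring.
Qed.

(** The constant 1 is the two points at infinity less the 1 subtracted in [S_ab]; [- p] compensates
    for letting the sum include [x = 0]. *)
Lemma S_abE (alpha beta : F) : beta != 0 ->
  (S_ab p iota alpha beta)%:~R = 1 - (q ^ n)%:R - p%:R +
    p%:R * \sum_(x : L)
      (Tr p (n * r) (iota beta * (iota alpha * x - x^-1)) == 0)%:R :> rat.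
Proof.
move=> beta0; rewrite /S_ab card_curve_points // card_L.
have affE : #|affine_points iota p alpha beta|%:R = p%:R *
    \sum_(x : L | x != 0)
      (Tr p (n * r) (iota beta * (iota alpha * x - x^-1)) == 0)%:R :> rat.
  rewrite -sum_nat_of_bool mulr_sumr [RHS]big_mkcond /=.
  rewrite -(pair_bigA _ (fun x y => ((x != 0) &&
    (y ^+ p - y == iota beta * (iota alpha * x - x^-1)))%:R)).
  apply: eq_bigr => x _ /=.
  case: (x != 0); last by rewrite big1.
  rewrite /= sum_nat_of_bool (card_exp_sub (n := (n * r)%N)) //.
  - by rewrite natrM mulrC.
  - by rewrite muln_gt0 n_gt0.
  - by rewrite card_L q_def -expnM mulnC.
(* By the default [0^-1 = 0], the term at [x = 0] equals 1. *)
rewrite [in RHS](bigD1 (0 : L)) //= invr0 mulr0 subrr mulr0 Tr0 // eqxx.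
rewrite rmorphB /= -!pmulrn -addn2 -[(q ^ n).+1]addn1 !natrD affE; ring.
Qed.

Lemma Tr_iotaM (a : F) (x : L) : Tr q n (iota a * x) = iota a * Tr q n x.
Proof. by rewrite TrMl // -rmorphXn -card_F expf_card. Qed.

(** The final formula with denominators cleared. Exchanging sums puts [x] outermost, where
    [sum_Tr0_scaled] and then [card_linear_solutions] apply for each [x]. *)
Lemma sum_S_ab :
  \sum_(alpha : F | alpha != 0) \sum_(beta in B) (S_ab p iota alpha beta)%:~R =
  q%:R ^+ 2 * (F00 L q n)%:R - q%:R ^+ n - (q%:R - 1) ^+ 2 :> rat.
Proof.
(* [s x] is the trace of [x] read in [F], so [s x^-1] is [rTr q n x] read in [F]. *)
have /fin_all_exists[s sE] := Tr_codom q_nat_L q_gt1 card_L iota card_F.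
have B_neq0 b : b \in B -> b != 0.
  by move/(subsetP (transversal_sub B_repr)); rewrite inE.
have p1_neq0 : p%:R - 1 != 0 :> rat.
  by rewrite -natr_pred pnatr_eq0 -lt0n -ltnS prednK.
have := sum1_neq0 F rat; rewrite card_F => sum1.
have card_B : (p%:R - 1) * \sum_(b in B) 1 = q%:R - 1 :> rat.
  by rewrite -natr_pred -(sum_coset_representatives F_pchar B_repr).
have Tr_x a b x :
  (Tr p (n * r) (iota b * (iota a * x - x^-1)) == 0) =
  (Tr p r (b * (a * s x - s x^-1)) == 0).
  rewrite Tr_tower // -q_def Tr_iotaM TrD // TrN // Tr_iotaM !sE.
  by rewrite -rmorphM -rmorphB -rmorphM Tr_rmorph fmorph_eq0.
have Tr0_s x : (Tr q n x == 0) = (s x == 0) by rewrite sE fmorph_eq0.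
have sum_s0 : \sum_x (s x == 0)%:R * q%:R = q%:R ^+ n :> rat.
  rewrite -mulr_suml; under eq_bigr => x _ do rewrite -Tr0_s.
  by rewrite sum_nat_of_bool card_Tr0 // -natrM -expnSr prednK // natrX.
(* Inversion, with [0^-1 = 0], permutes [L]. *)
have sum_sV0 : \sum_x (s x^-1 == 0)%:R * q%:R = q%:R ^+ n :> rat.
  by rewrite -sum_s0 [RHS](reindex_inj invr_inj).
have sum_F00 : \sum_x ((s x == 0) && (s x^-1 == 0))%:R = (F00 L q n)%:R :> rat.
  rewrite sum_nat_of_bool /F00; congr (_%:R); apply: eq_card => x.
  by rewrite !inE rTrE !Tr0_s.
have sum_1L : \sum_(x : L) 1 = q%:R ^+ n :> rat.
  by rewrite sumr_const card_L natrX.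
(* The factor [p - 1] turns the size of [B] into [q - 1] and gives the sum over [b] the shape of
   [sum_Tr0_scaled]. *)
have sum_beta a : a != 0 ->
  (p%:R - 1) * \sum_(b in B) (S_ab p iota a b)%:~R =
  (q%:R - 1) * (1 - q%:R ^+ n - p%:R) +
  \sum_x (q%:R - p%:R + (p%:R - 1) * q%:R * (a * s x - s x^-1 == 0)%:R) :> rat.
  move=> a0; under [X in _ = _ + X]eq_bigr => x _ do rewrite -sum_Tr0_scaled.
  rewrite (eq_bigr _ (fun b bB => S_abE a (B_neq0 b bB))) big_split /=.
  rewrite mulrDr -card_B -mulrA [(\sum_(b in B) 1) * _]mulr_suml.
  congr (_ * _ + _); first by apply: eq_bigr => b _; rewrite mul1r natrX.
  rewrite -!mulr_sumr exchange_big /=; congr (_ * (_ * _)).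
  by apply: eq_bigr => x _; apply: eq_bigr => b _; rewrite Tr_x.
apply: (mulfI p1_neq0); rewrite mulr_sumr (eq_bigr _ sum_beta) big_split /=.
rewrite exchange_big /=.
have -> : \sum_(a : F | a != 0) (q%:R - 1) * (1 - q%:R ^+ n - p%:R) =
  (q%:R - 1) * (q%:R - 1) * (1 - q%:R ^+ n - p%:R) :> rat.
  rewrite -[X in X * (q%:R - 1)]sum1 -mulrA mulr_suml.
  by apply: eq_bigr => a _; rewrite mul1r.
(* The explicit factors 1 let the constant terms be evaluated by [sum_1L] after the sum is split. *)
have -> : \sum_x \sum_(a : F | a != 0)
    (q%:R - p%:R + (p%:R - 1) * q%:R * (a * s x - s x^-1 == 0)%:R) =
  \sum_x ((q%:R - 1) * (q%:R - p%:R) * 1 + (p%:R - 1) *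
    (q%:R * 1 - (s x == 0)%:R * q%:R - (s x^-1 == 0)%:R * q%:R
      + q%:R ^+ 2 * ((s x == 0) && (s x^-1 == 0))%:R)) :> rat.
  apply: eq_bigr => x _; rewrite big_split /= -mulr_sumr card_linear_solutions.
  by rewrite -[X in \sum_(a | _) X]mul1r -mulr_suml sum1; ring.
rewrite big_split /= -!mulr_sumr !big_split /= !sumrN -!mulr_sumr.
by rewrite sum_1L sum_s0 sum_sV0 sum_F00; ring.
Qed.

End Counting.

Theorem theorem3 (p r q n : nat) (F L : finFieldType)
    (iota : {rmorphism F -> L}) (B : {set F})
    (p_prime : prime p) (q_def : q = (p ^ r)%N) (n_gt0 : (0 < n)%N)
    (card_F : #|F| = q) (card_L : #|L| = (q ^ n)%N)
    (B_repr : coset_representatives p B) :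
  (F00 L q n)%:R =
    q%:R ^ (n%:Z - 2) + (q%:R - 1) ^+ 2 / q%:R ^+ 2
    + (q%:R ^+ 2)^-1 *
      \sum_(alpha : F | alpha != 0) \sum_(beta in B)
         (S_ab p iota alpha beta)%:~R :> rat.
Proof.
have q_neq0 : q%:R != 0 :> rat.
  by rewrite pnatr_eq0 -card_F -lt0n (ltnW (finNzRing_gt1 F)).
rewrite (sum_S_ab iota p_prime q_def n_gt0 card_F card_L B_repr).
(* The exponent [n - 2] is negative for [n = 1]; splitting this integer power requires [q_neq0]. *)
by rewrite expfzDr // -exprnP -exprz_inv; field.
Qed.
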